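(* Let $m\ge 1$ be an integer. For every integer $N\ge 0$ let $H_N=\det\left(\gamma^{(2m)}_{i+j+1-m}(t)\right)_{i,j=0}^{N-1}$ (with $H_0=1$). Then $$H_N=\begin{cases}\xi_1\, t^{m^2n(n-1)/2}, & \text{if } N=mn \text{ with } n\ge 0,\\ 0, & \text{otherwise},\end{cases}$$ where $\xi_1=(-1)^{nm(m-1)/2}$.
   Context: The Narayana polynomials are $\gamma_n(t)=\sum_{k=0}^{n}\binom{n}{k}\binom{n-1}{k}\frac{1}{k+1}t^k$ (so $\gamma_0(t)=1$), with generating function $\gamma(t,q)=\sum_{n\ge0}\gamma_n(t)q^n$. Let $G(t,q)=(\gamma(t,q)-1)/q$. For $m\ge1$ the polynomials $\gamma^{(2m)}_n(t)$ are defined by $\sum_{n\ge0}\gamma^{(2m)}_n(t)q^n=G(t,q)^m$, and $\gamma^{(2m)}_i(t)=0$ for $i<0$. Equivalently, $\gamma^{(2m)}_{n-m}(t)$ is the coefficient of $q^n$ in $(\gamma(t,q)-1)^m$. *)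

(* Defs.v *)
From HB Require Import structures.
From mathcomp Require Import all_boot all_order all_algebra.
Set Implicit Arguments. Unset Strict Implicit. Unset Printing Implicit Defensive.
Import Order.TTheory GRing.Theory Num.Theory.
Local Open Scope ring_scope.

(* Narayana polynomial gamma_n(t) = sum_k C(n,k) C(n-1,k) /(k+1) t^k;
   for n = 0 this gives 1 (C(0,0) = 1), as in the paper. *)
Definition narayana (n : nat) : {poly rat} :=
  \sum_(k < n.+1)
     (('C(n, k))%:R * ('C(n.-1, k))%:R / (k.+1)%:R) *: 'X^k.

(* Truncation of gamma(t,q) - 1 up to degree d in q, as a polynomial in q
   with coefficients in {poly rat}. *)
Definition gammaM1_trunc (d : nat) : {poly {poly rat}} :=
  \sum_(1 <= k < d.+1) (narayana k)%:P * 'X^k.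

(* gamma^{(2m)}_i(t) = coefficient of q^(i+m) in (gamma(t,q)-1)^m for i >= 0,
   and 0 for i < 0.  Since gamma(t,q)-1 has no constant term, the coefficient
   of q^(i+m) in its m-th power only involves gamma_1 .. gamma_(i+m). *)
Definition gamma2m (m : nat) (i : int) : {poly rat} :=
  match i with
  | Posz n => ((gammaM1_trunc (n + m)%N) ^+ m)`_(n + m)
  | Negz _ => 0
  end.

Definition hankelH (m N : nat) : {poly rat} :=
  \det (\matrix_(i < N, j < N) gamma2m m (i%:Z + j%:Z + 1 - m%:Z)).

(* Main.v *)
Require Import Defs.
From HB Require Import structures.
From mathcomp Require Import all_boot all_order all_algebra.
From mathcomp Require Import ring zify.
Set Implicit Arguments. Unset Strict Implicit. Unset Printing Implicit Defensive.
Import GRing.Theory Num.Theory.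
Local Open Scope ring_scope.

(** Put [w = gamma - 1], so that [w = q (1 + w) (1 + t w)].  Extracting coefficients
    from [w^m] gives [c (m+1) (n+1) = c m n + (1 + t) c (m+1) n + t c (m+2) n] for
    [c m n = [q^(n+1)] w^m]; equivalently, the linear functional [f] with moments
    [f(X^n) = c m n] reads off the coefficient of [U_m] in the basis of Lucas
    (Chebyshev) polynomials [U_n = U_n(X - (1 + t), t)].  The same recurrence
    holds for the binomial expression [ballot], which at [m = 1] is the Narayana
    polynomial.

    The Hankel determinant of the moments of [f] is its Gram determinant in any
    basis of monic polynomials of degrees 0, 1, 2, ...  With
    [W_k = U_(k+1)(V_m, t^m)] one has [f (W_i W_j U_m) = [i = j] t^(m i)], while
    [f (W_i W_j U_n) = 0] if [m] does not divide [n].  Hence in the basis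
    [W_i X^r], [0 <= r < m], the Gram matrix is block diagonal with blocks of
    size [m] vanishing above the antidiagonal, on which the [i]-th block is
    constantly [t^(m i)]; a last block truncated to size [0 < r < m] has a zero row. *)

Lemma nat_ind2 (P : nat -> Prop) :
  P 0%N -> P 1%N -> (forall n, P n -> P n.+1 -> P n.+2) -> forall n, P n.
Proof.
move=> P0 P1 PS n; suff [] : P n /\ P n.+1 by [].
by elim: n => [|n [Pn Pn1]]; split=> //; apply: PS.
Qed.

(** * Lucas sequences and their product formulas *)

Section Lucas.
Variables (A : comNzRingType) (p q : A).

Fixpoint lucasU (n : nat) : A :=
  match n with
  | 0 => 0
  | n1.+1 => match n1 with 0 => 1 | n2.+1 => p * lucasU n1 - q * lucasU n2 end
  end.

Fixpoint lucasV (n : nat) : A :=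
  match n with
  | 0 => 2
  | n1.+1 => match n1 with 0 => p | n2.+1 => p * lucasV n1 - q * lucasV n2 end
  end.

Lemma lucasUSS n : lucasU n.+2 = p * lucasU n.+1 - q * lucasU n.
Proof. by []. Qed.

Lemma lucasVSS n : lucasV n.+2 = p * lucasV n.+1 - q * lucasV n.
Proof. by []. Qed.

Lemma lucasU2 : lucasU 2 = p.
Proof. by rewrite /= mulr0 subr0 mulr1. Qed.

(** With [x], [y] the roots of [T^2 - p T + q], [U_n = (x^n - y^n)/(x - y)] and [V_m = x^m + y^m];
    expand, using [x y = q]. The induction works because both sides obey the same recurrence in
    [m]. *)
Lemma lucasVU_add m n :
  lucasV m * lucasU (n + m) = lucasU (n + m + m) + q ^+ m * lucasU n.
Proof.
elim/nat_ind2: m n => [n|n|m IH0 IH1 n].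
- by rewrite !addn0 /=; ring.
- by rewrite !addn1 lucasUSS /=; ring.
have := IH0 n.+2; have := IH1 n.+1.
rewrite !addnS !addSn !lucasVSS (lucasUSS n) => E1 E0.
rewrite mulrBl -(mulrA p) -(mulrA q (lucasV _)) E1 E0 (lucasUSS (n + m + m).+2).
rewrite (exprS q m.+1) (exprS q m); ring.
Qed.

Lemma lucasVS n : lucasV n.+1 = lucasU n.+2 - q * lucasU n.
Proof.
elim/nat_ind2: n => [||n IH0 IH1]; try by rewrite /=; ring.
by rewrite lucasVSS IH1 IH0 !lucasUSS; ring.
Qed.

(** Serves where [lucasVU_add] would need a negative index, through [U_(-m) = - U_m / q^m]. *)
Lemma lucasVU_sub m n :
  lucasV (n + m) * lucasU n = lucasU (n + n + m) - q ^+ n * lucasU m.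
Proof.
elim/nat_ind2: n m => [m|m|n IH0 IH1 m].
- by rewrite /=; ring.
- by rewrite !addSn !add0n lucasVS expr1 mulr1.
have := IH0 m.+2; have := IH1 m.+1.
rewrite !addnS !addSn !lucasUSS (exprS _ n.+1) (exprS _ n) => E1 E0.
rewrite mulrBr (mulrCA _ p) E1 (mulrCA _ q) E0; ring.
Qed.

End Lucas.

Section LucasPoly.
Variables (R : comNzRingType) (p : {poly R}) (c : R) (d : nat).
Hypotheses (p_monic : p \is monic) (size_p : size p = d.+2).

Lemma lucasU_poly n :
  lucasU p c%:P n.+1 \is monic /\ size (lucasU p c%:P n.+1) = (d.+1 * n).+1.
Proof.
elim/nat_ind2: n => [||n [_ s0] [m1 s1]].
- by rewrite monic1 muln0 size_poly1.
- by rewrite /= mulr0 subr0 mulr1 muln1.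
rewrite lucasUSS.
have mM : p * lucasU p c%:P n.+2 \is monic by rewrite monicMl.
have sM : size (p * lucasU p c%:P n.+2) = (d.+1 * n.+2).+1.
  by rewrite size_monicM ?monic_neq0 // size_p s1; lia.
have lt : (size (- (c%:P * lucasU p c%:P n.+1))%R < size (p * lucasU p c%:P n.+2)%R)%N.
  rewrite size_polyN mul_polyC sM (leq_ltn_trans (size_scale_leq _ _)) // s0; lia.
by split; rewrite ?size_polyDl // monicE lead_coefDl // -monicE.
Qed.

End LucasPoly.

Lemma lucasV_poly (R : comNzRingType) (p : {poly R}) (c : R) n :
  p \is monic -> size p = 2 ->
  lucasV p c%:P n.+1 \is monic /\ size (lucasV p c%:P n.+1) = n.+2.
Proof.
move=> mp sp; rewrite lucasVS.
have [m2 s2] := lucasU_poly c mp sp n.+1.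
have lt : (size (- (c%:P * lucasU p c%:P n))%R < size (lucasU p c%:P n.+2))%N.
  rewrite size_polyN mul_polyC s2 (leq_ltn_trans (size_scale_leq _ _)) //.
  case: n {m2 s2} => [|n]; first by rewrite size_poly0.
  by have [_ ->] := lucasU_poly c mp sp n; lia.
split; first by rewrite monicE lead_coefDl // -monicE.
by rewrite size_polyDl // s2 mul1n.
Qed.

(** * Linear functionals on polynomials *)

Lemma scalar_polyZ (R : comNzRingType) (f : {scalar {poly R}}) c (p : {poly R}) :
  f (c *: p) = c * f p.
Proof. by rewrite linearZ. Qed.

Lemma scalar_polyC_mul (R : comNzRingType) (f : {scalar {poly R}}) c (p : {poly R}) :
  f (c%:P * p) = c * f p.
Proof. by rewrite mul_polyC scalar_polyZ. Qed.

(** Subtracting a multiple of the monic [b n] lowers the degree. [f] is a bare function so that it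
    can be instantiated by [p => f (W i * W j * p)]. *)
Lemma scalar_eq0_basis (R : comNzRingType) (f : {poly R} -> R)
    (b : nat -> {poly R}) n :
  scalar f ->
  (forall k, (k < n)%N -> [/\ b k \is monic, size (b k) = k.+1 & f (b k) = 0]) ->
  forall p : {poly R}, (size p <= n)%N -> f p = 0.
Proof.
move=> f_lin.
have f0 : f 0 = 0 by have := f_lin (-1) 0 0; rewrite scaler0 addr0 mulN1r addNr.
elim: n => [_ p|n IH hb p sp].
  by rewrite leqn0 size_poly_eq0 => /eqP ->.
have [mb sb fb] := hb n (ltnSn n).
have -> : p = p`_n *: b n + (p - p`_n *: b n) by rewrite addrC subrK.
rewrite f_lin fb mulr0 add0r; apply: IH => [k kn|].
  by apply: hb; apply: ltnW.
apply/leq_sizeP => j; rewrite leq_eqVlt => /orP [/eqP <-|nj].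
  move/monicP: mb; rewrite coefB coefZ lead_coefE sb /= => ->.
  by rewrite mulr1 subrr.
have sbj : (size (b n) <= j)%N by rewrite sb.
by rewrite coefB coefZ (nth_default _ (leq_trans sp nj)) (nth_default _ sbj) mulr0 subrr.
Qed.

(** * Values of the functional on products [W_i W_j p] *)

Section Functional.
Variables (R : comNzRingType) (a t : R) (m' : nat).
Let m := m'.+1.
Let z : {poly R} := 'X - a%:P.
Let U := lucasU z t%:P.
Let V := lucasV z t%:P.
Let W k := lucasU (V m) ((t ^+ m)%:P) k.+1.
Variable f : {scalar {poly R}}.
Hypothesis fU : forall n, f (U n) = (n == m)%:R.

(* The span of the [U n] with [m] not dividing [n] is stable under
   multiplication by [V m], by the product formulas for [V m * U n]. *)
Let avoids p := forall n, ~~ (m %| n)%N -> f (p * U n) = 0.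

Lemma avoids_mulV p : avoids p -> avoids (V m * p).
Proof.
move=> hp n hn; rewrite (mulrC _ p) -mulrA; case: (leqP m n) => [mn|nm].
  rewrite -(subnK mn) lucasVU_add mulrDr linearD /=.
  rewrite hp; last by rewrite -addnA !dvdn_addl // ?dvdn_add // -(@dvdn_addl m) // subnK.
  rewrite mulrCA -polyC_exp scalar_polyC_mul hp ?mulr0 ?addr0 //.
  by rewrite -(@dvdn_addl m) // subnK.
(* For [n < m] the product is [V_m U_n = U_(m+n) - t^n U_(m-n)]. *)
have e : m = (n + (m - n))%N by rewrite subnKC // ltnW.
rewrite {1}e lucasVU_sub mulrBr linearB /=.
rewrite hp; last by rewrite -addnA -e dvdn_addl.
rewrite mulrCA -polyC_exp scalar_polyC_mul hp ?mulr0 ?subr0 //.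
by move: hn; apply: contra => h; rewrite -(@dvdn_addl (m - n)) // -e.
Qed.

Lemma avoids_mulW k p : avoids p -> avoids (W k * p).
Proof.
move=> hp; elim/nat_ind2: k => [||k IH0 IH1].
- by rewrite /W mul1r.
- by rewrite /W lucasU2; apply: avoids_mulV.
move=> n hn; rewrite /W lucasUSS mulrBl mulrBl linearB /=.
rewrite -!(mulrA (V m)) mulrA avoids_mulV // -!(mulrA (_%:P)) scalar_polyC_mul.
by rewrite IH0 // mulr0 subr0.
Qed.

Lemma W_mulU k : W k * U m = U (k.+1 * m).
Proof.
elim/nat_ind2: k => [||k IH0 IH1]; first by rewrite /W mul1r mul1n.
  rewrite /W lucasU2 mul2n -addnn.
  (* The added zero is [t^m U_0]. *)
  by rewrite -[RHS]addr0 -(mulr0 (t%:P ^+ m)); apply: lucasVU_add z t%:P m 0%N.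
rewrite /W lucasUSS mulrBl -!mulrA IH1 IH0.
have := lucasVU_add z t%:P m (k.+1 * m).
rewrite -[(_ * m + m)%N]addnC -mulSn -/U -/V => ->.
by rewrite addnC -mulSn polyC_exp addrK.
Qed.

Lemma f_WU k b : f (W k * U (b * m)) = (t ^+ (m * k)) *+ (b == k.+1).
Proof.
elim/nat_ind2: k b => [b|b|k IH0 IH1 b].
- rewrite /W mul1r fU muln0 expr0; congr (_ *+ nat_of_bool _).
  by rewrite -{2}(mul1n m) eqn_pmul2r.
- rewrite /W lucasU2 muln1; case: b => [|b].
    by rewrite mul0n mulr0 linear0.
  rewrite mulSn addnC lucasVU_add linearD /= -polyC_exp scalar_polyC_mul -/U !fU.
  have -> : (b * m + m + m == m)%N = false by apply/negbTE/eqP; rewrite /m; lia.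
  by rewrite -{3}(mul1n m) eqn_pmul2r // eqSS add0r mulr_natr.
case: b => [|b]; first by rewrite mul0n mulr0 linear0.
rewrite /W lucasUSS mulrBl linearB -!mulrA scalar_polyC_mul IH0.
rewrite mulrCA mulSn addnC lucasVU_add mulrDr linearD.
rewrite addnC (addnC _ m) -!mulSn mulrCA -polyC_exp scalar_polyC_mul !IH1 !eqSS.
(* The term from [U_((b+2)m)] cancels the one subtracted for [W_k]; the term from [t^m U_(bm)]
   remains. *)
by rewrite !mulnS !exprD -!mulrnAr addrAC subrr add0r.
Qed.

Lemma U_poly n : U n.+1 \is monic /\ size (U n.+1) = n.+1.
Proof.
have [? ->] := lucasU_poly t (monicXsubC a) (size_XsubC a) n.
by rewrite mul1n.
Qed.

Lemma f_WW_scalar i j : scalar (fun p => f (W i * W j * p)).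
Proof. by move=> c p q; rewrite mulrDr -scalerAr linearP. Qed.

(** In this range [m] is the only multiple of [m], so every other [n] falls under [avoids]. *)
Lemma f_WWU i j n : (0 < n < m + m)%N ->
  f (W i * W j * U n) = (t ^+ (m * i)) *+ ((n == m) && (i == j)).
Proof.
move=> /andP [n0 n2]; have [->|nm] := eqVneq n m.
  by rewrite -mulrA W_mulU f_WU eqSS eq_sym.
have avW : avoids (W i * W j).
  rewrite -[W j]mulr1; do 2!apply: avoids_mulW; move=> k hk.
  by rewrite mul1r fU; case: eqP hk => // ->; rewrite dvdnn.
rewrite avW //; apply/negP => /dvdnP [k e]; move: n0 n2 nm; rewrite e /m.
by case: k {e} => [|[|k]]; rewrite ?mul1n ?eqxx //; lia.
Qed.

(** Such [p] lie in the span of [U_1, ..., U_(m-1)]; the index is shifted since [U_(k+1)] has degree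
    [k]. *)
Lemma f_WW_small i j (p : {poly R}) : (size p < m)%N -> f (W i * W j * p) = 0.
Proof.
move=> sp; apply: (scalar_eq0_basis (b := fun k => U k.+1) (f_WW_scalar i j) _ (n := m')).
  move=> k km; have [? ?] := U_poly k; split=> //.
  by rewrite f_WWU /m ?eqSS ?(ltn_eqF km) //; lia.
by [].
Qed.

(** The bound admits every [X^(r+s)] with [r, s < m], hence whole off-diagonal blocks. *)
Lemma f_WW_neq i j (p : {poly R}) : i != j -> (size p < m + m)%N ->
  f (W i * W j * p) = 0.
Proof.
move=> ij sp.
apply: (scalar_eq0_basis (b := fun k => U k.+1) (f_WW_scalar i j) _ (n := (m + m).-1)).
  move=> k km; have [? ?] := U_poly k; split=> //.
  by rewrite f_WWU ?(negbTE ij) ?andbF //; lia.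
by lia.
Qed.

Lemma f_WW_monic i j (p : {poly R}) : p \is monic -> size p = m ->
  f (W i * W j * p) = (t ^+ (m * i)) *+ (i == j).
Proof.
move=> mp sp; have [mU sU] := U_poly m'.
have -> : p = U m + (p - U m) by rewrite addrC subrK.
rewrite mulrDr linearD f_WWU; last by rewrite /m; lia.
rewrite eqxx /= f_WW_small ?addr0 // ltnS.
apply/leq_sizeP => k; rewrite leq_eqVlt => /orP [/eqP <-|mk].
  move/monicP: mp; move/monicP: mU.
  by rewrite !lead_coefE sp sU coefB /= => -> ->; rewrite subrr.
by rewrite coefB !nth_default ?subrr ?sU ?sp.
Qed.

Definition block_basis n : {poly R} := W (n %/ m) * 'X^(n %% m).

Lemma block_basis_poly n : block_basis n \is monic /\ size (block_basis n) = n.+1.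
Proof.
have [mV sV] := lucasV_poly t m' (monicXsubC a) (size_XsubC a).
have [mW sW] := lucasU_poly (t ^+ m) mV sV (n %/ m).
split; first by rewrite monicMl ?monicXn.
rewrite size_monicM ?monic_neq0 ?monicXn // sW size_polyXn.
by rewrite addSn addnS mulnC -divn_eq.
Qed.

Lemma f_block_basis i j r s : (r < m)%N -> (s < m)%N ->
  f (block_basis (i * m + r) * block_basis (j * m + s)) = f (W i * W j * 'X^(r + s)).
Proof.
move=> rm sm; rewrite /block_basis !divnMDl // !modnMDl !modn_small //.
by rewrite !divn_small // !addn0 exprD mulrACA.
Qed.

End Functional.

(** * Gram determinants and change of basis *)

(** The coefficient matrix [A] of the [b i] is lower unitriangular, and the Gram matrix is [A H A^T]
    with [H] the Hankel matrix. *)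
Lemma det_gram_monic (R : comNzRingType) (f : {scalar {poly R}})
    (b : nat -> {poly R}) N :
  (forall n, b n \is monic /\ size (b n) = n.+1) ->
  \det (\matrix_(i < N, j < N) f (b i * b j)) =
  \det (\matrix_(i < N, j < N) f 'X^(i + j)).
Proof.
move=> hb; pose A := \matrix_(i < N, k < N) (b i)`_k.
have detA : \det A = 1.
  rewrite det_trig.
    apply: big1 => i _; rewrite mxE; have [/monicP + s] := hb i.
    by rewrite lead_coefE s.
  by apply/is_trig_mxP => i j ij; rewrite mxE nth_default // (hb i).2.
have bE (i : 'I_N) : b i = \sum_(k < N) A i k *: 'X^k.
  rewrite -[LHS]coefK poly_def (hb i).2.
  rewrite (big_ord_widen N (fun k => (b i)`_k *: 'X^k)) //.
  rewrite big_mkcond; apply: eq_bigr => k _; rewrite mxE; case: ifP => // /negbT.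
  by rewrite -leqNgt => ki; rewrite nth_default ?scale0r // (hb i).2.
have -> : \matrix_(i < N, j < N) f (b i * b j)
    = A *m (\matrix_(i < N, j < N) f 'X^(i + j)) *m A^T.
  apply/matrixP => i j; rewrite !mxE (bE i) (bE j) mulr_sumr linear_sum /=.
  apply: eq_bigr => l _; rewrite !mxE -scalerAr scalar_polyZ mulrC; congr (_ * _).
  rewrite mulr_suml linear_sum; apply: eq_bigr => k _.
  by rewrite -scalerAl scalar_polyZ [X in _ = _ * X]mxE exprD.
by rewrite !det_mulmx det_tr detA mul1r mulr1.
Qed.

(** * Determinants of block and antitriangular matrices *)

Section NatDet.
Variable R : comNzRingType.

(** Entries indexed by [nat] turn a sub-block into a mere index shift. *)
Definition natdet N (F : nat -> nat -> R) := \det (\matrix_(i < N, j < N) F i j).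

Lemma natdet_block p q F :
  (forall i j, (i < p)%N -> (j < q)%N -> F i (p + j)%N = 0) ->
  natdet (p + q) F = natdet p F * natdet q (fun i j => F (p + i)%N (p + j)%N).
Proof.
move=> F0; rewrite /natdet -(det_lblock _ (\matrix_(i < q, j < p) F (p + i)%N j)).
congr (\det _); apply/matrixP => i j; rewrite !mxE.
case: (split_ordP i) => i' ->; rewrite !mxE; case: (split_ordP j) => j' ->; rewrite !mxE //=.
by rewrite F0.
Qed.

Lemma natdet_antitrig m F c :
  (forall i j, (i + j < m.-1)%N -> F i j = 0) ->
  (forall i j, (i + j).+1 = m -> F i j = c) ->
  natdet m F = (-1) ^+ 'C(m, 2) * c ^+ m.
Proof.
elim: m F => [F _ _|m IH F F0 Fc]; first by rewrite /natdet det_mx00 mulr1.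
rewrite /natdet (expand_det_row _ ord0) big_ord_recr big1 => [|j _] /=.
  (* The last entry of the first row has cofactor sign [(-1)^m], matching
     [C(m+1,2) = C(m,2) + m]. *)
  rewrite add0r mxE Fc // /cofactor add0n binS bin1 exprD (exprS c).
  have -> : row' ord0 (col' ord_max (\matrix_(i < m.+1, j < m.+1) F i j)) =
      \matrix_(i < m, j < m) F i.+1 j.
    apply/matrixP => i j; rewrite !mxE /= /bump leq0n add1n.
    by rewrite leqNgt ltn_ord.
  rewrite -/(natdet m (fun i j => F i.+1 j)) IH => [|i j ij|i j ij].
  - rewrite !mulrA; congr (_ * _).
    by rewrite -mulrA mulrC (mulrC _ ((-1) ^+ 'C(m, 2))).
  - by apply: F0; lia.
  - by apply: Fc; lia.
by rewrite mxE F0 ?mul0r //=; case: j.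
Qed.

Lemma natdet_row0 N F i : (i < N)%N -> (forall j, (j < N)%N -> F i j = 0) ->
  natdet N F = 0.
Proof.
move=> iN F0; rewrite /natdet (expand_det_row _ (Ordinal iN)) big1 // => j _.
by rewrite mxE F0 ?mul0r.
Qed.

End NatDet.

(** * The Gram determinant in the block basis *)

Section BlockGram.
Variables (R : comNzRingType) (a t : R) (m' : nat).
Let m := m'.+1.
Variable f : {scalar {poly R}}.
Hypothesis fU : forall n, f (lucasU ('X - a%:P) t%:P n) = (n == m)%:R.
Let b := block_basis a t m'.
Let G i j := f (b i * b j).

Lemma gram_neq i j r s : i != j -> (r < m)%N -> (s < m)%N ->
  G (i * m + r) (j * m + s) = 0.
Proof.
by move=> ij rm sm; rewrite /G f_block_basis // (f_WW_neq fU) // size_polyXn; lia.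
Qed.

Lemma gram_above i r s : (r + s < m')%N -> G (i * m + r) (i * m + s) = 0.
Proof.
by move=> rs; rewrite /G f_block_basis ?(f_WW_small fU) // ?size_polyXn /m; lia.
Qed.

Lemma gram_antidiag i r s : (r + s)%N = m' -> G (i * m + r) (i * m + s) = t ^+ (m * i).
Proof.
move=> rs; rewrite /G f_block_basis ?(f_WW_monic fU) ?monicXn ?size_polyXn ?rs ?eqxx //;
  rewrite /m; lia.
Qed.

Lemma det_gram_block_basis n :
  natdet (n * m) G = (-1) ^+ (n * 'C(m, 2)) * t ^+ (m ^ 2 * 'C(n, 2)).
Proof.
elim: n => [|n IH]; first by rewrite /natdet det_mx00 mul0n muln0 mulr1.
rewrite [(_.+1 * m)%N]mulSnr natdet_block => [|i j inm jm]; last first.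
  by rewrite (divn_eq i m) gram_neq ?ltn_mod // neq_ltn ltn_divLR // inm.
rewrite IH (natdet_antitrig (c := t ^+ (m * n))) => [|i j ij|i j [ij]].
(* The new block contributes [(t^(mn))^m], and [C(n+1,2) = C(n,2) + n]. *)
- rewrite -exprM (binS n 1) bin1 (mulSnr n) (mulnDr (m ^ 2)%N) !(exprD _ (_ * _)%N) mulrACA.
  by congr (_ * (_ * _ ^+ _)); rewrite -mulnn mulnAC.
- exact: gram_above.
- exact: gram_antidiag.
Qed.

Lemma det_gram_block_basis0 N : ~~ (m %| N)%N -> natdet N G = 0.
Proof.
rewrite /dvdn -lt0n => r0; have rm : (N %% m < m)%N by rewrite ltn_mod.
have eN := divn_eq N m.
(* The first row of the truncated block: its columns [s < N %% m <= m'] stop short of the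
   antidiagonal. *)
apply: (@natdet_row0 _ _ _ (N %/ m * m)) => [|j jN]; first lia.
rewrite -[(N %/ m * m)%N]addn0 (divn_eq j m).
have [ji|ji] := eqVneq (j %/ m)%N (N %/ m)%N; last by rewrite gram_neq ?ltn_mod // eq_sym.
rewrite ji gram_above // add0n; have := divn_eq j m; rewrite ji; move: jN rm; rewrite /m; lia.
Qed.

End BlockGram.

(** * Functionals with prescribed moments *)

Section Moment.
Variable R : comNzRingType.

Definition moment (c : nat -> R) (p : {poly R}) := \sum_(i < size p) p`_i * c i.

Lemma momentE c n (p : {poly R}) : (size p <= n)%N ->
  moment c p = \sum_(i < n) p`_i * c i.
Proof.
move=> sp; rewrite /moment (big_ord_widen n (fun i => p`_i * c i)) // big_mkcond.
apply: eq_bigr => i _; case: ltnP => // ip.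
by rewrite nth_default // mul0r.
Qed.

Fact moment_scalar c : scalar (moment c).
Proof.
move=> a p q; pose n := maxn (size p) (size q).
have sp : (size p <= n)%N by rewrite leq_maxl.
have sq : (size q <= n)%N by rewrite leq_maxr.
have s : (size (a *: p + q)%R <= n)%N.
  by rewrite (leq_trans (size_polyD _ _)) // geq_max sq (leq_trans (size_scale_leq _ _)).
rewrite !(@momentE c n) // mulr_sumr -big_split; apply: eq_bigr => i _ /=.
by rewrite coefD coefZ mulrDl mulrA.
Qed.

HB.instance Definition _ c :=
  GRing.isLinear.Build R {poly R} R *%R (moment c) (moment_scalar c).

Lemma momentB c p q : moment c (p - q) = moment c p - moment c q.
Proof. exact: linearB. Qed.

Lemma moment_polyC_mul c a p : moment c (a%:P * p) = a * moment c p.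
Proof. exact: scalar_polyC_mul. Qed.

Lemma momentXn c n : moment c 'X^n = c n.
Proof.
rewrite /moment size_polyXn (bigD1 ord_max) //= coefXn eqxx mul1r big1 ?addr0 // => i.
by rewrite coefXn -val_eqE => /negbTE ->; rewrite mul0r.
Qed.

Lemma momentXM c p : moment c ('X * p) = moment (fun i => c i.+1) p.
Proof.
rewrite (@momentE _ (size p).+1); last first.
  by rewrite (leq_trans (size_polyMleq _ _)) // size_polyX.
by rewrite big_ord_recl coefXM mul0r add0r; apply: eq_bigr => i _; rewrite coefXM.
Qed.

Variables (a t : R) (c : nat -> nat -> R).
Hypothesis c0 : forall n, c 0%N n = 0.
Hypothesis c_0 : forall m, c m 0%N = (m == 1%N)%:R.
Hypothesis cS : forall m n, c m.+1 n.+1 = c m n + a * c m.+1 n + t * c m.+2 n.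

Lemma moment_shift m p : moment (c m.+1) (('X - a%:P) * p) =
  moment (c m) p + t * moment (c m.+2) p.
Proof.
rewrite mulrBl momentB moment_polyC_mul momentXM /moment !mulr_sumr -sumrB -big_split.
by apply: eq_bigr => i _ /=; rewrite cS; ring.
Qed.

(** Write [L_m] for [moment (c m)]. By [moment_shift], [L_(m+1)(U_(n+2)) = L_m(U_(n+1)) + t
    L_(m+2)(U_(n+1)) - t L_(m+1)(U_n)], and the last two terms cancel by induction. *)
Lemma moment_lucasU m n :
  moment (c m.+1) (lucasU ('X - a%:P) t%:P n) = (n == m.+1)%:R.
Proof.
elim/nat_ind2: n m => [m|m|n IH0 IH1 m]; first by rewrite linear0.
  by rewrite -[lucasU _ _ 1]/('X^0) momentXn c_0 eq_sym.
rewrite lucasUSS momentB moment_polyC_mul moment_shift IH0 IH1 eqSS addrK.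
by case: m => [|m]; rewrite ?IH1 ?eqSS //; apply: big1 => i _; rewrite c0 mulr0.
Qed.

End Moment.

(** * Closed form for the moments *)

(* The coefficient of [w^(N - d)] in [((1 + w) (1 + t w))^N]. *)
Definition trinom N d : {poly rat} := \poly_(k < N.+1) ('C(N, k) * 'C(N, k + d))%:R.

Lemma coef_trinom N d k : (trinom N d)`_k = ('C(N, k) * 'C(N, k + d))%:R.
Proof. by rewrite coef_poly; case: ltnP => // Nk; rewrite bin_small. Qed.

(** Multiplication by [(1 + w)(1 + t w) = 1 + (1 + t) w + t w^2]. *)
Lemma trinomS N d : trinom N.+1 d.+1 =
  trinom N d + (1 + 'X) * trinom N d.+1 + 'X * trinom N d.+2.
Proof.
apply/polyP => k; rewrite mulrDl mul1r !coefD !coefXM !coef_trinom.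
case: k => [|k] /=; first by rewrite !add0n binS !bin0 !mul1n natrD; ring.
rewrite -!natrD; congr (_%:R).
by rewrite !addSn !addnS !binS; ring.
Qed.

(** The factor 2 comes from the symmetry [w -> 1/(t w)]: the coefficient of [w^(N+1)] is [t] times
    that of [w^(N-1)]. *)
Lemma trinomS0 N : trinom N.+1 0 = (1 + 'X) * trinom N 0 + 'X * trinom N 1 *+ 2.
Proof.
apply/polyP => k; rewrite mulrDl mul1r -mulrnAr !coefD !coefXM coefMn !coef_trinom.
case: k => [|k] /=; first by rewrite !bin0.
rewrite -mulrnA -!natrD !addn0 addn1; congr (_%:R).
by rewrite !binS; ring.
Qed.

(** Lagrange inversion: with [phi = (1 + w)(1 + t w)] one has [phi - w phi' = 1 - t w^2], so
    [[q^(n+1)] w^m = [w^(n+1-m)] phi^n (1 - t w^2)]. *)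
Definition ballot m n : {poly rat} :=
  if m is m1.+1 then trinom n m1 - 'X * trinom n m1.+2 else 0.

Lemma trinom_small N d : (N < d)%N -> trinom N d = 0.
Proof.
move=> Nd; apply/polyP => k; rewrite coef_trinom coef0 (bin_small (m := k + d)) ?muln0 //.
exact: ltn_addl.
Qed.

Lemma ballot0 m : ballot m 0 = (m == 1%N)%:R.
Proof.
case: m => [|[|m]] //; rewrite /ballot (@trinom_small 0 _.+2) // mulr0 subr0;
  last by rewrite trinom_small.
by rewrite /trinom poly_def big_ord1 !bin0 scale1r expr0.
Qed.

Lemma ballotS m n : ballot m.+1 n.+1 =
  ballot m n + (1 + 'X) * ballot m.+1 n + 'X * ballot m.+2 n.
Proof.
case: m => [|m] /=; rewrite ?trinomS0 !trinomS; ring.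
Qed.

Lemma ballot_small m n : (n.+1 < m)%N -> ballot m n = 0.
Proof. by case: m => // m nm; rewrite /ballot !trinom_small ?mulr0 ?subr0 //; lia. Qed.

(** Compares coefficients of [t^(k+1)] in [narayana (n+1)] and [ballot 1 n], with the denominator
    [k+2] cleared. *)
Lemma bin_narayana n k :
  ('C(n.+1, k.+1) * 'C(n, k.+1) + k.+2 * ('C(n, k) * 'C(n, k.+2)) =
   k.+2 * ('C(n, k.+1) * 'C(n, k.+1)))%N.
Proof.
have [nk|kn] := leqP n k; first by rewrite (@bin_small n k.+1) ?(@bin_small n k.+2) ?muln0 //; lia.
have := mul_bin_left n k; have := mul_bin_left n k.+1.
rewrite binS -(subnKC kn); set e := (n - k.+1)%N.
have -> : (k.+1 + e - k.+1 = e)%N by lia.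
have -> : (k.+1 + e - k = e.+1)%N by lia.
move: 'C(_, k) 'C(_, k.+1) 'C(_, k.+2) => x y w E1 E2.
have -> : (k.+2 * (x * w) = x * (e * y))%N by rewrite -E1 mulnCA.
have -> : (k.+2 * (y * y) = y * y + (k.+1 * y) * y)%N by ring.
by rewrite E2; ring.
Qed.

Lemma narayana_ballot n : narayana n.+1 = ballot 1 n.
Proof.
rewrite /narayana -(poly_def _ (fun k => 'C(n.+1, k)%:R * 'C(n, k)%:R / k.+1%:R)).
apply/polyP => k; rewrite coef_poly coefB coefXM !coef_trinom.
have -> : (if (k < n.+2)%N then 'C(n.+1, k)%:R * 'C(n, k)%:R / k.+1%:R else 0) =
    ('C(n.+1, k) * 'C(n, k))%:R / k.+1%:R :> rat.
  by rewrite -natrM; case: ltnP => // nk; rewrite bin_small // mul0r.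
case: k => [|k] /=; first by rewrite !bin0 divr1 subr0.
rewrite addn0 addn2; apply: (mulIf (_ : k.+2%:R != 0 :> rat)); first by rewrite pnatr_eq0.
rewrite divfK ?pnatr_eq0 // mulrBl -!natrM (mulnC _ k.+2) -bin_narayana.
by rewrite natrD (mulnC _ k.+2) addrK.
Qed.

(** * The functional equation for [w], modulo powers of [q] *)

Definition agree (R : nzRingType) d (p q : {poly R}) :=
  forall i, (i <= d)%N -> p`_i = q`_i.

Section Agree.
Variable R : comNzRingType.
Implicit Types p q : {poly R}.

Lemma agreeM d p1 q1 p2 q2 :
  agree d p1 q1 -> agree d p2 q2 -> agree d (p1 * p2) (q1 * q2).
Proof.
move=> h1 h2 i id; rewrite !coefM; apply: eq_bigr => -[k /= ki] _.
by rewrite h1 ?h2 // (leq_trans _ id) // leq_subr.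
Qed.

Lemma agreeX d p q m : agree d p q -> agree d (p ^+ m) (q ^+ m).
Proof.
by move=> h; elim: m => [//|m IH]; rewrite (exprS p m) (exprS q m); apply: agreeM.
Qed.

Variable t : R.

Definition mstep p := 'X * ((1 + p) * (1 + t%:P * p)).

(** The factor ['X] gains one order, so iterating [mstep] from 0 approximates its fixed point
    [w]. *)
Lemma mstep_agree d p q : agree d p q -> agree d.+1 (mstep p) (mstep q).
Proof.
move=> h [|i] id; rewrite !coefXM //=.
apply: (@agreeM d) => [j jd|j jd|]; last exact: id.
  by rewrite !coefD h.
by rewrite !coefD !coefCM h.
Qed.

Lemma mstep_fix d : exists p, agree d p (mstep p).
Proof.
exists (iter d mstep 0); elim: d => [|d IH]; last exact: mstep_agree.
by move=> i; rewrite leqn0 => /eqP ->; rewrite coefXM coef0.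
Qed.

Lemma mstep_coef_exp d p m n : agree d p (mstep p) -> (n < d)%N ->
  (p ^+ m.+1)`_n.+1 =
  (p ^+ m)`_n + (1 + t) * (p ^+ m.+1)`_n + t * (p ^+ m.+2)`_n.
Proof.
(* Only one factor of the power is replaced by its [mstep]. *)
move=> hp nd; rewrite [in LHS]exprSr (agreeM (fun i _ => erefl (p ^+ m)`_i) hp nd).
rewrite /mstep mulrCA coefXM /=.
have -> : p ^+ m * ((1 + p) * (1 + t%:P * p)) =
    p ^+ m + (1 + t)%:P * p ^+ m.+1 + t%:P * p ^+ m.+2.
  by rewrite (exprSr p m.+1) (exprSr p m) polyCD polyC1; ring.
by rewrite !coefD !coefCM.
Qed.

End Agree.

Lemma exp_ballot d (p : {poly {poly rat}}) m n : agree d p (mstep 'X p) -> (n < d)%N ->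
  (p ^+ m)`_n.+1 = ballot m n.
Proof.
move=> hp; have p0 : p`_0 = 0 by rewrite hp // coefXM.
have pm0 k : (p ^+ k)`_0 = (k == 0%N)%:R.
  by rewrite -horner_coef0 horner_exp horner_coef0 p0 expr0n.
elim: n m => [|n IH] [|m] nd; rewrite ?coef1 // (mstep_coef_exp _ hp nd).
  by rewrite !pm0 ballot0 !mulr0 !addr0 eqSS.
by rewrite ballotS !IH // ltnW.
Qed.

Lemma coef_gammaM1 d i : (i <= d)%N ->
  (gammaM1_trunc d)`_i = if i is n.+1 then ballot 1 n else 0.
Proof.
move=> id; rewrite /gammaM1_trunc coef_sum.
rewrite (eq_bigr (fun k => if k == i then narayana k else 0)) => [|k _]; last first.
  by rewrite coefCM coefXn eq_sym; case: eqP; rewrite ?mulr1 ?mulr0.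
rewrite -big_mkcond big_nat1_eq.
by case: i id => [|i] id //; rewrite ltn0Sn ltnS id narayana_ballot.
Qed.

(** The case [m = 1] of [exp_ballot] identifies the truncated Narayana series with the approximate
    fixed point; its powers follow. *)
Lemma gammaM1_exp d m n : (n < d)%N -> (gammaM1_trunc d ^+ m)`_n.+1 = ballot m n.
Proof.
have [p hp] := @mstep_fix {poly rat} 'X d; move=> nd.
have gp : agree d (gammaM1_trunc d) p.
  move=> [|i] id; rewrite coef_gammaM1 //; first by rewrite hp // coefXM.
  by rewrite -[p]expr1 (exp_ballot _ hp).
by rewrite -(exp_ballot m hp nd); apply: (agreeX m gp).
Qed.

(** * Hankel entries as moments, and the conclusion *)

Lemma gamma2m_ballot m i j : (1 <= m)%N ->
  gamma2m m (i%:Z + j%:Z + 1 - m%:Z) = ballot m (i + j).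
Proof.
move=> m1; have [ij|ij] := leqP m (i + j).+1.
  have -> : i%:Z + j%:Z + 1 - m%:Z = ((i + j).+1 - m)%N :> int by lia.
  by rewrite /gamma2m subnK // gammaM1_exp.
(* At a negative index [ballot] vanishes too, since [w^m] has order at least [m] in [q]. *)
have [k ->] : exists k, i%:Z + j%:Z + 1 - m%:Z = Negz k.
  by exists (m - (i + j).+2)%N; lia.
by rewrite ballot_small.
Qed.

Lemma muln_pred_bin2 n : (n * (n - 1) = 'C(n, 2) * 2)%N.
Proof.
rewrite bin2 -divn2 divnK ?subn1 // dvdn2 oddM.
by case: n => [|n] //=; rewrite andNb.
Qed.

Theorem theorem1p5 (m N : nat) (hm : (1 <= m)%N) :
  hankelH m N =
  (if (m %| N)%N then
     (-1) ^+ ((N %/ m) * m * (m - 1) %/ 2)%N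
       * 'X^(m ^ 2 * (N %/ m) * (N %/ m - 1) %/ 2)%N
   else 0).
Proof.
case: m hm => // m' _.
have fU := moment_lucasU (fun n => erefl : ballot 0 n = 0) ballot0 ballotS m'.
have -> : hankelH m'.+1 N = \det (\matrix_(i < N, j < N) moment (ballot m'.+1) 'X^(i + j)).
  by congr (\det _); apply/matrixP => i j; rewrite !mxE momentXn gamma2m_ballot.
rewrite -(det_gram_monic (moment (ballot m'.+1)) N (block_basis_poly (1 + 'X) 'X m')).
case: ifPn => [mN|mN]; last exact: (det_gram_block_basis0 fU).
have := det_gram_block_basis fU (N %/ m'.+1); rewrite {1}(divnK mN) /natdet => ->.
by rewrite -(mulnA (N %/ _)%N) -(mulnA (_ ^ _)%N) !muln_pred_bin2 !(mulnA _ 'C(_, _)) !mulnK.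
Qed.
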